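(* Let $\mathbf{A}\in\mathbb{R}^{n\times m}$ with $m>n$ be a deterministic matrix whose columns $\mathbf{a}_1,\dots,\mathbf{a}_m$ satisfy $\|\mathbf{a}_i\|_2=1$, and let $\mu$ be its mutual coherence. Let $\mathbf{x}_0=(x_{0,1},\dots,x_{0,m})^T\in\mathbb{R}^m$ be a deterministic nonzero vector with known sparsity $\|\mathbf{x}_0\|_0=s$ and support $\Lambda_0$, and let $|x_{\min}|=\min_{i\in\Lambda_0}|x_{0,i}|$ and $|x_{\max}|=\max_{i\in\Lambda_0}|x_{0,i}|$. Let $\mathbf{b}=\mathbf{A}\mathbf{x}_0+\mathbf{w}$, where $\mathbf{w}\sim N(\mathbf{0},\sigma^2\mathbf{I})$ is a random noise vector in $\mathbb{R}^n$, $\sigma>0$. (i) Suppose that $$|x_{\min}|-(2s-1)\mu|x_{\min}|\ge 2\sigma\sqrt{2(1+\alpha)\log m}$$ for some constant $\alpha>0$. Then, with probability at least $$1-\frac{1}{m^\alpha\sqrt{\pi(1+\alpha)\log m}},$$ the orthogonal matching pursuit (OMP) estimate $\hat{\mathbf{x}}_{\mathrm{OMP}}$ identifies the correct support $\Lambda_0$ of $\mathbf{x}_0$ and, furthermore, satisfies $$\|\hat{\mathbf{x}}_{\mathrm{OMP}}-\mathbf{x}_0\|_2^2\le\frac{2(1+\alpha)}{(1-(s-1)\mu)^2}\,s\sigma^2\log m\le 8(1+\alpha)s\sigma^2\log m.$$ (ii) If the stronger condition $$|x_{\min}|-(2s-1)\mu|x_{\max}|\ge 2\sigma\sqrt{2(1+\alpha)\log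 m}$$ holds, then with probability exceeding $$1-\frac{1}{m^\alpha\sqrt{\pi(1+\alpha)\log m}},$$ the thresholding algorithm also correctly identifies $\Lambda_0$, and its estimate $\hat{\mathbf{x}}_{\mathrm{th}}$ satisfies $$\|\hat{\mathbf{x}}_{\mathrm{th}}-\mathbf{x}_0\|_2^2\le\frac{2(1+\alpha)}{(1-(s-1)\mu)^2}\,s\sigma^2\log m\le 8(1+\alpha)s\sigma^2\log m.$$
   Context: $\|\mathbf{x}\|_0$ denotes the number of nonzero entries of $\mathbf{x}$; the support of $\mathbf{x}$ is the set of indices of its nonzero entries. The mutual coherence of $\mathbf{A}$ is $\mu=\max_{i\neq j}|\mathbf{a}_i^T\mathbf{a}_j|$. Logarithms are natural. Probability is with respect to $\mathbf{w}$. For an index set $\Lambda$, $\mathbf{A}_\Lambda$ is the submatrix of $\mathbf{A}$ formed by the columns indexed by $\Lambda$, and $\dagger$ denotes the Moore–Penrose pseudoinverse. The least-squares (LS) estimate on $\Lambda$ is the vector in $\mathbb{R}^m$ equal to $\mathbf{A}_\Lambda^\dagger\mathbf{b}$ on $\Lambda$ and zero elsewhere. Thresholding algorithm: let $\Lambda$ be the set of indices of the $s$ columns $\mathbf{a}_i$ having the highest correlations $|\mathbf{a}_i^T\mathbf{b}|$ with $\mathbf{b}$; the estimate $\hat{\mathbf{x}}_{\mathrm{th}}$ is the LS estimate on $\Lambda$. The algorithm correctly identifies the support if $\Lambda=\Lambda_0$. OMP: initialize $\Lambda^0=\emptyset$, $\mathbf{r}^0=\mathbf{b}$. For $i=1,\dots,s$: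 let $k_i$ be an index $k$ maximizing $|\mathbf{a}_k^T\mathbf{r}^{i-1}|$; set $\Lambda^i=\Lambda^{i-1}\cup\{k_i\}$; let $\hat{\mathbf{x}}_{\mathrm{OMP}}^i$ be the LS estimate on $\Lambda^i$; set $\mathbf{r}^i=\mathbf{b}-\mathbf{A}\hat{\mathbf{x}}_{\mathrm{OMP}}^i$. The OMP estimate is $\hat{\mathbf{x}}_{\mathrm{OMP}}=\hat{\mathbf{x}}_{\mathrm{OMP}}^s$. OMP identifies the correct support if $\Lambda^s=\Lambda_0$. *)

(* Defs.v *)
From HB Require Import structures.
From mathcomp Require Import all_boot all_order all_algebra.
From mathcomp Require Import all_classical all_reals all_analysis.
Set Implicit Arguments. Unset Strict Implicit. Unset Printing Implicit Defensive.
Import Order.TTheory GRing.Theory Num.Theory.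
Import numFieldNormedType.Exports.
Local Open Scope ring_scope.

Section LinearAlgebra.
Variable R : realType.

Definition dot (n : nat) (u v : 'cV[R]_n) : R := (u^T *m v) 0 0.

(* Euclidean norm; the library norm on matrices is the sup norm. *)
Definition norm2 (n : nat) (u : 'cV[R]_n) : R := Num.sqrt (\sum_i u i 0 ^+ 2).

Definition supp (m : nat) (x : 'cV[R]_m) : {set 'I_m} := [set i | x i 0 != 0].

Definition norm0 (m : nat) (x : 'cV[R]_m) : nat := #|supp x|.

Definition max_abs (m : nat) (x : 'cV[R]_m) : R :=
  \big[Num.max/0]_(i in supp x) `|x i 0|.

(* The default value max_abs x never affects the result: it dominates every
   term, and for x != 0 the range is nonempty. *)
Definition min_abs (m : nat) (x : 'cV[R]_m) : R :=
  \big[Num.min/max_abs x]_(i in supp x) `|x i 0|.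

(* All terms are nonnegative, so for m >= 2 this is the maximum over i <> j. *)
Definition coherence (n m : nat) (A : 'M[R]_(n, m)) : R :=
  \big[Num.max/0]_(i < m) \big[Num.max/0]_(j < m | j != i)
    `|dot (col i A) (col j A)|.

Definition moore_penrose (p q : nat) (M : 'M[R]_(p, q)) (X : 'M[R]_(q, p)) :=
  [/\ M *m X *m M = M, X *m M *m X = X,
      (M *m X)^T = M *m X & (X *m M)^T = X *m M].

(* Mxalgebra's pinvmx is only some generalised inverse, not the Moore-Penrose
   one; existence and uniqueness are pinvP and moore_penrose_unique. *)
Definition pinv (p q : nat) (M : 'M[R]_(p, q)) : 'M[R]_(q, p) :=
  xget 0 (moore_penrose M : set 'M[R]_(q, p)).

Lemma moore_penrose_unique (p q : nat) (M : 'M[R]_(p, q)) X Y :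
  moore_penrose M X -> moore_penrose M Y -> X = Y.
Proof.
move=> [M1 X1 S1 T1] [M2 X2 S2 T2].
have E1 : M *m X = M *m Y.
  rewrite -[LHS]S1 -{1}M2 -[M *m Y *m M *m X]mulmxA trmx_mul S1 S2.
  by rewrite mulmxA M1.
have E2 : X *m M = Y *m M.
  rewrite -[LHS]T1 -{1}M2 -[M *m Y *m M]mulmxA mulmxA trmx_mul T1 T2.
  by rewrite -mulmxA [M *m (X *m M)]mulmxA M1.
by rewrite -X1 E2 -mulmxA E1 mulmxA X2.
Qed.

Lemma gram_unit (p q : nat) (F : 'M[R]_(p, q)) :
  row_free F -> F *m F^T \in unitmx.
Proof.
move=> Ffree; rewrite -row_free_unit -kermx_eq0 -submx0.
apply/rV_subP => u /sub_kermxP uF0; rewrite submx0.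
have E : (u *m F) *m (u *m F)^T = 0.
  by rewrite trmx_mul mulmxA -(mulmxA u) uF0 mul0mx.
have /eqP : \sum_j (u *m F) 0 j ^+ 2 = 0.
  move/matrixP: E => /(_ 0 0); rewrite mxE [RHS]mxE => E.
  by rewrite -[RHS]E; apply: eq_bigr => j _; rewrite [_^T _ _]mxE expr2.
rewrite psumr_eq0 => [/allP uF|j _]; last exact: sqr_ge0.
rewrite -(mulmx_free_eq0 _ Ffree); apply/eqP/rowP => j.
have := uF j (mem_index_enum j); rewrite sqrf_eq0 => /eqP ->.
by rewrite mxE.
Qed.

Lemma pinvP (p q : nat) (M : 'M[R]_(p, q)) : moore_penrose M (pinv M).
Proof.
rewrite /pinv; apply: (@xgetPex _ 0 (moore_penrose M)).
have := col_base_full M; have := row_base_free M; have := mulmx_base M.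
move: (col_base M) (row_base M) => C F /esym MCF Ffree Cfull.
have FU : F *m F^T \in unitmx by exact: gram_unit.
have CU : C^T *m C \in unitmx.
  by rewrite -{2}[C]trmxK gram_unit // /row_free mxrank_tr.
set X := F^T *m invmx (F *m F^T) *m (invmx (C^T *m C) *m C^T).
have FX : F *m X = invmx (C^T *m C) *m C^T.
  by rewrite /X !mulmxA mulmxV // mul1mx.
have XC : X *m C = F^T *m invmx (F *m F^T).
  by rewrite /X -!mulmxA mulVmx // mulmx1.
have CVC : invmx (C^T *m C) *m C^T *m C = 1%:M by rewrite -mulmxA mulVmx.
exists X; split.
- by rewrite MCF -[C *m F *m X]mulmxA FX -mulmxA
    (mulmxA (invmx _ *m C^T)) CVC mul1mx.
- by rewrite MCF (mulmxA X) XC -(mulmxA _ F) FX.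
- by rewrite MCF -(mulmxA C) FX !trmx_mul trmxK trmx_inv trmx_mul trmxK mulmxA.
- by rewrite MCF (mulmxA X) XC !trmx_mul trmxK trmx_inv trmx_mul trmxK mulmxA.
Qed.

Definition submx_cols (n m : nat) (A : 'M[R]_(n, m)) (L : {set 'I_m}) :
  'M[R]_(n, #|L|) := colsub (fun k : 'I_#|L| => enum_val k) A.

(* For i in L exactly one k : 'I_#|L| satisfies enum_val k = i, and the sum is
   the corresponding entry of pinv A_L *m b; for i outside L the sum is empty. *)
Definition ls_estimate (n m : nat) (A : 'M[R]_(n, m)) (b : 'cV[R]_n)
    (L : {set 'I_m}) : 'cV[R]_m :=
  \col_i \sum_(k < #|L| | enum_val k == i) (pinv (submx_cols A L) *m b) k 0.

(* Ties may be broken arbitrarily, so thresholding and OMP are relations; the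
   existence lemmas below show that both always have an output. *)
Definition threshold_support (n m : nat) (A : 'M[R]_(n, m)) (b : 'cV[R]_n)
    (s : nat) (L : {set 'I_m}) : Prop :=
  #|L| = s /\
  forall i j, i \in L -> j \notin L ->
    `|dot (col j A) b| <= `|dot (col i A) b|.

(* omp_state A b i L x r: after i iterations the algorithm may have index set L,
   estimate x and residual r. *)
Inductive omp_state (n m : nat) (A : 'M[R]_(n, m)) (b : 'cV[R]_n) :
    nat -> {set 'I_m} -> 'cV[R]_m -> 'cV[R]_n -> Prop :=
| omp_init : omp_state A b 0 finset.set0 0 b
| omp_step (i : nat) (L : {set 'I_m}) (x : 'cV[R]_m) (r : 'cV[R]_n)
    (k : 'I_m) :
    omp_state A b i L x r ->
    (forall j, `|dot (col j A) r| <= `|dot (col k A) r|) ->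
    omp_state A b i.+1 (k |: L) (ls_estimate A b (k |: L))
      (b - A *m ls_estimate A b (k |: L)).

Lemma threshold_support_exists (n m : nat) (A : 'M[R]_(n, m)) b s :
  (s <= m)%N -> exists L, threshold_support A b s L.
Proof.
elim: s => [_|s IH sm].
  by exists finset.set0; split=> [|i j]; rewrite ?cards0 ?finset.in_set0.
have [L [cL hL]] := IH (ltnW sm).
have [k0] : exists k0, k0 \in ~: L.
  by apply/finset.set0Pn; rewrite -card_gt0 cardsCs finset.setCK card_ord cL subn_gt0.
rewrite finset.in_setC => k0L.
have [k kL kmax] := @Order.TotalTheory.arg_maxP _ _ _ k0 (fun k => k \notin L)
  (fun k => `|dot (col k A) b|) k0L.
exists (k |: L); split; first by rewrite cardsU1 kL cL.
move=> i j; rewrite !inE negb_or => /orP[/eqP->|iL] /andP[_ jL].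
  exact: kmax.
exact: hL.
Qed.

Lemma omp_state_exists (n m : nat) (A : 'M[R]_(n, m)) b s :
  (0 < m)%N -> exists L x r, omp_state A b s L x r.
Proof.
move=> m0; elim: s => [|s [L [x [r H]]]].
  by exists finset.set0, 0, b; exact: omp_init.
have [k _ kmax] := @Order.TotalTheory.arg_maxP _ _ _ (Ordinal m0) xpredT
  (fun k => `|dot (col k A) r|) isT.
by do 3 eexists; apply: (omp_step (k := k) H) => j; exact: kmax.
Qed.

End LinearAlgebra.

Section Gaussian.
Context d (T : measurableType d) (R : realType) (P : probability T R).
Local Open Scope classical_set_scope.
Local Open Scope ereal_scope.

Definition mutually_independent (n : nat) (X : 'I_n -> {RV P >-> R}) : Prop :=
  forall (J : {set 'I_n}) (B : 'I_n -> set R),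
    (forall i, measurable (B i)) ->
    P [set t | forall i, i \in J -> B i (X i t)] =
    \prod_(i in J) P (X i @^-1` B i).

(* The law N(0, sigma^2 I); sigma is the standard deviation. *)
Definition white_gaussian (n : nat) (sigma : R) (X : 'I_n -> {RV P >-> R}) :
    Prop :=
  mutually_independent X /\
  forall i (B : set R), measurable B ->
    distribution P (X i) B = normal_prob 0 sigma B.

End Gaussian.

(* Main.v *)
Require Import Defs.
From HB Require Import structures.
From mathcomp Require Import all_boot all_order all_algebra.
From mathcomp Require Import ring lra.
From mathcomp Require Import all_classical all_reals all_analysis.
From mathcomp Require Import measurable_realfun.
Import Order.TTheory GRing.Theory Num.Theory.
Import numFieldNormedType.Exports.
Local Open Scope classical_set_scope.
Local Open Scope ring_scope.

(** Everything happens on the event N that |<a_k, w>| < tau for every column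
    a_k, where tau = sigma sqrt (2 (1 + alpha) ln m).

    On N, both algorithms succeed for deterministic reasons. Correlating
    A z + w with a column a_j gives z_j, plus cross terms of size at most
    mu max |z| from each other active column, plus noise below tau
    ([interference_le]). Under the margin assumed on z, a column of the support
    therefore beats every column outside it
    ([support_correlation_dominates]). With z = x0 this is the success of
    thresholding ([threshold_recovers]). For OMP it is applied at each step to
    z = x0 - (current estimate), whose largest entry is at least |x_min| as
    long as an index of the support is missing; the residual is orthogonal to
    the columns already selected, so each step selects a new index of the
    support ([omp_state_support]). Once the support is known, the normal
    equations and the same interference estimate bound each entry of the error
    by tau / (1 - (s - 1) mu) ([ls_error_entry_le]), which gives the squared
    error bound ([oracle_ls_accurate]).

    It remains to bound the probability that N fails. Since a_k is a unit
    vector, <a_k, w> has law N(0, sigma ^ 2) ([law_combination]); this rests on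
    the convolution of two normal laws ([normal_prob_convolution]) and an
    induction that adds one coordinate at a time. The Gaussian tail is strictly
    below 2 sigma ^ 2 / tau times the density at tau ([normal_prob_abs_ge_lt]),
    and the union bound over the m columns already yields exactly the
    probability in the statement ([tail_constant]); the strictness of the tail
    estimate gives the strict inequality of part (ii).

    The success events are measurable because index sets range over a finite
    type, while estimates, residuals and correlations attached to a fixed index
    set are measurable functions of the noise. *)

Set Implicit Arguments.
Unset Strict Implicit.

(** * Events and random vectors indexed by finite types *)

Section finite_measurability.
Context d (T : measurableType d) (R : realType).

Lemma measurable_forall (I : finType) (Q : I -> T -> Prop) :
  (forall i, measurable [set t | Q i t]) ->
  measurable [set t | forall i, Q i t].
Proof.
move=> mQ.
rewrite [X in measurable X](_ : _ = \bigcap_(i in [set: I]) [set t | Q i t]).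
  by apply: fin_bigcap_measurable => // i _; exact: mQ.
by apply/seteqP; split => t /= h i; [move=> _|]; exact: h.
Qed.

Lemma measurable_exists (I : finType) (Q : I -> T -> Prop) :
  (forall i, measurable [set t | Q i t]) ->
  measurable [set t | exists i, Q i t].
Proof.
move=> mQ.
rewrite [X in measurable X](_ : _ = \bigcup_(i in [set: I]) [set t | Q i t]).
  by apply: fin_bigcup_measurable => // i _; exact: mQ.
by apply/seteqP; split => t /= [i]; [|move=> _]; exists i.
Qed.

Lemma measurable_cst_prop (p : Prop) : measurable [set _ : T | p].
Proof.
have [hp|hp] := pselect p.
  by rewrite (_ : [set _ | p] = setT)//; apply/seteqP; split.
by rewrite (_ : [set _ | p] = set0)//; apply/seteqP; split.
Qed.

Lemma measurable_implies (Q1 Q2 : T -> Prop) :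
  measurable [set t | Q1 t] -> measurable [set t | Q2 t] ->
  measurable [set t | Q1 t -> Q2 t].
Proof.
move=> m1 m2.
rewrite [X in measurable X](_ : _ = ~` [set t | Q1 t] `|` [set t | Q2 t]).
  by apply: measurableU => //; exact: measurableC.
apply/seteqP; split => t /=; last by case=> [h /h|h _].
by have [h /(_ h)|h _] := pselect (Q1 t); [right|left].
Qed.

Lemma measurable_ler (f g : T -> R) :
  measurable_fun setT f -> measurable_fun setT g ->
  measurable [set t | f t <= g t].
Proof.
move=> mf mg; have := measurable_fun_ler mf mg.
move=> /(_ measurableT [set true]); rewrite setTI; exact.
Qed.

Lemma measurable_mulmx_entry p q (M : 'M[R]_(p, q)) (v : T -> 'cV[R]_q) i :
  (forall j, measurable_fun setT (fun t => v t j 0)) ->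
  measurable_fun setT (fun t => (M *m v t) i 0).
Proof.
move=> mv; under eq_fun do rewrite mxE.
by apply: measurable_sum => j; exact: measurable_funM.
Qed.
End finite_measurability.

(** * Convolution of centred normal laws *)

Section normal_law.
Context {R : realType}.
Local Open Scope ereal_scope.
Local Notation mu := (@lebesgue_measure R).

(** The source and target carry the measurable structure on which Lebesgue
    measure is built, so that the pushforward of that measure is itself a
    measure on the same type. *)
Definition affine (a c : R) : measurableTypeR R -> measurableTypeR R :=
  fun x => (a * x + c)%R.

Lemma measurable_affine (a c : R) :
  measurable_fun [set: measurableTypeR R] (affine a c).
Proof. by apply: measurable_funD => //; exact: measurable_funM. Qed.

HB.instance Definition _ (a c : R) :=
  isMeasurableFun.Build _ _ _ _ (affine a c) (measurable_affine a c).

(** Half-open intervals determine Lebesgue measure, and an affine map sends an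
    interval to an interval whose length is scaled by |a|; the two signs of a
    differ only in which end is closed. *)
Lemma lebesgue_measure_affine (a c : R) (B : set R) :
  a != 0%R -> measurable B -> mu B = `|a|%:E * mu (affine a c @^-1` B).
Proof.
move=> a0 mB; have na : (0 <= `|a|)%R by [].
have itv_affine (x y : R) :
    mu `]x, y]%classic = `|a|%:E * mu (affine a c @^-1` `]x, y]%classic).
  rewrite lebesgue_measure_itv/= lte_fin.
  have [alt0|agt0|] := ltgtP a 0%R; last by move/eqP; rewrite (negbTE a0).
  - have -> : affine a c @^-1` `]x, y]%classic
       = `[((y - c) / a)%R, ((x - c) / a)%R[%classic.
      apply/seteqP; split => z /=;
        by rewrite !in_itv/= ler_ndivrMr// ltr_ndivlMr// /affine lerBrDr
             ltrBlDr mulrC andbC.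
    rewrite lebesgue_measure_itv/= lte_fin ltr_nM2r ?invr_lt0// ltrD2r.
    case: ifPn => _; last by rewrite mule0.
    by rewrite -!EFinB -EFinM ltr0_norm//; congr (_%:E); field.
  - have -> : affine a c @^-1` `]x, y]%classic
       = `]((x - c) / a)%R, ((y - c) / a)%R]%classic.
      apply/seteqP; split => z /=;
        by rewrite !in_itv/= ler_pdivlMr// ltr_pdivrMr// /affine lerBrDr
             ltrBlDr mulrC.
    rewrite lebesgue_measure_itv/= lte_fin ltr_pM2r ?invr_gt0// ltrD2r.
    case: ifPn => _; last by rewrite mule0.
    by rewrite -!EFinB -EFinM gtr0_norm//; congr (_%:E); field.
apply: (@lebesgue_measure_unique R
  (mscale (NngNum na) (pushforward mu (affine a c)))) => // _ [[x y] _ <-].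
exact: itv_affine.
Qed.

Lemma ge0_integral_affine (a c : R) (f : R -> \bar R) : a != 0%R ->
  (forall x, 0 <= f x) -> measurable_fun setT f ->
  \int[mu]_x f x = \int[mu]_x (`|a|%:E * f (a * x + c)%R).
Proof.
move=> a0 f0 mf; have na : (0 <= `|a|)%R by [].
have mac := measurable_affine a c.
rewrite ge0_integralZl//; last exact: (measurableT_comp mf).
rewrite -[X in _ = _ * X](ge0_integral_pushforward mac mu measurableT)//.
rewrite -(ge0_integral_mscale (pushforward mu (affine a c)) measurableT
  (NngNum na))//.
apply: eq_measure_integral => A mA _; exact: lebesgue_measure_affine.
Qed.

(** By uniqueness of the Radon-Nikodym derivative, the density of a normal law
    is its explicit density almost everywhere. *)
Lemma ge0_integral_normal_prob (m s : R) (f : R -> \bar R) :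
  (forall x, 0 <= f x) -> measurable_fun setT f ->
  \int[normal_prob m s]_x f x = \int[mu]_x (f x * (normal_pdf m s x)%:E).
Proof.
move=> f0 mf.
have dom := normal_prob_dominates m s.
rewrite -(@Radon_Nikodym_SigmaFinite.change_of_variables _ _ _ _ _ dom)//.
apply: ae_eq_integral => //.
- apply: emeasurable_funM => //; apply: (measurable_int mu).
  exact: Radon_Nikodym_SigmaFinite.f_integrable.
- apply: emeasurable_funM => //=; apply/measurableT_comp => //=.
  exact: measurable_normal_pdf.
- apply: ae_eqe_mul2l => /=.
  apply: integral_ae_eq => //=.
  + exact: Radon_Nikodym_SigmaFinite.f_integrable.
  + by apply/measurableT_comp => //; exact: measurable_normal_pdf.
  + by move=> E _ mE; rewrite -Radon_Nikodym_SigmaFinite.f_integral.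
Qed.

Lemma measurable_indic_normal_pdf (m s : R) (B : set R) : measurable B ->
  measurable_fun setT (fun x => (\1_B x)%:E * (normal_pdf m s x)%:E).
Proof.
move=> mB; apply: emeasurable_funM.
  exact/measurable_EFinP/measurable_indic.
by apply/measurable_EFinP; exact: measurable_normal_pdf.
Qed.

Lemma indic_normal_pdf_ge0 (m s : R) (B : set R) (x : R) :
  0 <= (\1_B x)%:E * (normal_pdf m s x)%:E.
Proof. by rewrite -EFinM lee_fin mulr_ge0// normal_pdf_ge0. Qed.

Lemma measurable_preimage_mul (a : R) (B : set R) : measurable B ->
  measurable ((fun x => (a * x)%R) @^-1` B).
Proof.
by move=> mB; rewrite -[X in measurable X]setTI; exact: mulrl_measurable.
Qed.

Lemma measurable_preimage_add (B : set R) : measurable B ->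
  measurable [set xy : R * R | B (xy.1 + xy.2)%R].
Proof.
move=> mB; have madd : measurable_fun [set: R * R] (fun xy => (xy.1 + xy.2)%R).
  exact: measurable_funD.
by rewrite -[X in measurable X]setTI; exact: madd.
Qed.

Lemma normal_prob_indic (m s : R) (B : set R) : measurable B ->
  normal_prob m s B = \int[mu]_x ((\1_B x)%:E * (normal_pdf m s x)%:E).
Proof.
move=> mB; rewrite -ge0_integral_normal_prob//.
- by rewrite integral_indic// setIT.
- exact/measurable_EFinP/measurable_indic.
Qed.

Lemma normal_pdf0E (s x : R) : s != 0%R ->
  normal_pdf 0 s x =
  ((Num.sqrt (s ^+ 2 * pi *+ 2))^-1 * expR (- x ^+ 2 / (s ^+ 2 *+ 2)))%R.
Proof. by move=> s0; rewrite normal_pdfE// /normal_fun subr0. Qed.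

Lemma normal_prob_scale (a s : R) (B : set R) : a != 0%R -> s != 0%R ->
  measurable B ->
  normal_prob 0 s ((fun x => (a * x)%R) @^-1` B) = normal_prob 0 (a * s) B.
Proof.
move=> a0 s0 mB.
have as0 : (a * s)%R != 0%R by rewrite mulf_neq0.
rewrite (normal_prob_indic _ _ (measurable_preimage_mul a mB)).
rewrite (normal_prob_indic _ _ mB).
rewrite [RHS](ge0_integral_affine 0 a0 (indic_normal_pdf_ge0 _ _ B)
  (measurable_indic_normal_pdf _ _ mB)).
apply: eq_integral => x _; rewrite !addr0 muleCA; congr (_ * _).
rewrite -EFinM !normal_pdf0E//; congr _%:E.
have -> : ((a * s) ^+ 2 * pi *+ 2 = a ^+ 2 * (s ^+ 2 * pi *+ 2))%R by ring.
rewrite sqrtrM ?sqr_ge0// sqrtr_sqr invfM !mulrA divff ?normr_eq0// mul1r.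
by congr (_ * expR _)%R; field; rewrite a0 s0.
Qed.

(** Completing the square in x: as a function of x, the integrand of the
    convolution at z is a constant times another normal density, so that its
    integral needs no computation. *)
Lemma normal_pdfM (u v x z : R) : u != 0%R -> v != 0%R ->
  let w := Num.sqrt (u ^+ 2 + v ^+ 2) in
  (normal_pdf 0 u x * normal_pdf 0 v (z - x) =
   normal_pdf 0 w z * normal_pdf (z * u ^+ 2 / w ^+ 2) (u * v / w) x)%R.
Proof.
move=> u0 v0 w.
have uv0 : (0 < u ^+ 2 + v ^+ 2)%R by rewrite ltr_wpDl ?sqr_ge0 ?exprn_even_gt0.
have w2 : (w ^+ 2 = u ^+ 2 + v ^+ 2)%R by rewrite sqr_sqrtr// ltW.
have w0 : w != 0%R by rewrite gt_eqF// sqrtr_gt0.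
have s0 : (u * v / w)%R != 0%R by rewrite !mulf_neq0 ?invr_eq0.
rewrite !normal_pdfE// /normal_peak /normal_fun !subr0.
rewrite mulrACA [RHS]mulrACA -!expRD -!invfM; congr (_^-1 * expR _)%R.
  rewrite -!sqrtrM; last 2 first.
  - by rewrite mulrn_wge0// mulr_ge0 ?sqr_ge0 ?pi_ge0.
  - by rewrite mulrn_wge0// mulr_ge0 ?sqr_ge0 ?pi_ge0.
  by congr Num.sqrt; field.
have h : (u ^+ 2 + v ^+ 2)%R != 0%R by rewrite gt_eqF.
have -> : ((u * v / w) ^+ 2 = u ^+ 2 * v ^+ 2 / (u ^+ 2 + v ^+ 2))%R.
  by rewrite -w2; field.
by rewrite w2; field; rewrite u0 v0 h.
Qed.

(** Fubini after the translation y = z - x; the inner integral over x is then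
    evaluated by the factorisation [normal_pdfM]. *)
Lemma normal_prob_convolution (u v : R) (B : set R) : u != 0%R -> v != 0%R ->
  measurable B ->
  (normal_prob 0 u \x normal_prob 0 v) [set xy | B (xy.1 + xy.2)%R] =
  normal_prob 0 (Num.sqrt (u ^+ 2 + v ^+ 2)) B.
Proof.
move=> u0 v0 mB; set w := Num.sqrt _.
rewrite /product_measure1.
pose h (xz : R * R) := (\1_B xz.2)%:E * (normal_pdf 0 v (xz.2 - xz.1))%:E
  * (normal_pdf 0 u xz.1)%:E.
have mh : measurable_fun setT h.
  apply: emeasurable_funM; last first.
    apply/measurable_EFinP; apply: measurableT_comp => //.
    exact: measurable_normal_pdf.
  apply: emeasurable_funM; last first.
    apply/measurable_EFinP; apply: measurableT_comp.
      exact: measurable_normal_pdf.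
    exact: measurable_funB.
  by apply/measurable_EFinP; apply: measurableT_comp => //.
have h0 x : 0 <= h x.
  by rewrite /h -!EFinM lee_fin !mulr_ge0// normal_pdf_ge0.
pose S := [set xy : R * R | B (xy.1 + xy.2)%R].
have mS : measurable S := measurable_preimage_add mB.
transitivity (\int[mu]_x \int[mu]_z h (x, z)).
  rewrite ge0_integral_normal_prob//; last exact: measurable_fun_xsection.
  apply: eq_integral => x _ /=.
  have mSx : measurable (xsection S x) by exact: measurable_xsection.
  have mg := measurable_indic_normal_pdf 0 v mSx.
  have g0 := indic_normal_pdf_ge0 0 v (xsection S x).
  rewrite (normal_prob_indic _ _ mSx).
  rewrite (ge0_integral_affine (- x) (oner_neq0 R) g0 mg).
  rewrite -ge0_integralZr//; first last.
  - by rewrite lee_fin normal_pdf_ge0.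
  - by move=> y _; rewrite mule_ge0// indic_normal_pdf_ge0.
  - apply: emeasurable_funM => //; apply: (measurableT_comp mg).
    by apply: measurable_funD => //; exact: measurable_funM.
  apply: eq_integral => z _.
  rewrite normr1 mul1e mul1r /h /=; congr (_%:E * _ * _).
  rewrite !indicE; congr (_%:R); congr nat_of_bool.
  by apply/idP/idP => /[!inE]; rewrite /S /xsection /= inE /= subrKC.
transitivity (\int[mu]_z \int[mu]_x h (x, z)); first exact: fubini_tonelli.
rewrite (normal_prob_indic _ _ mB).
apply: eq_integral => z _.
transitivity (\int[mu]_x (((\1_B z)%:E * (normal_pdf 0 w z)%:E) *
    (normal_pdf (z * u ^+ 2 / w ^+ 2) (u * v / w) x)%:E)).
  apply: eq_integral => x _; rewrite /h /= -!EFinM.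
  rewrite -[in LHS]mulrA -[in RHS](mulrA (\1_B z)); congr (_ * _)%R%:E.
  by rewrite mulrC normal_pdfM.
rewrite ge0_integralZl//=; first by rewrite integral_normal_pdf mule1.
- by apply/measurable_EFinP; exact: measurable_normal_pdf.
- by move=> x _; rewrite lee_fin normal_pdf_ge0.
- exact: indic_normal_pdf_ge0.
Qed.
End normal_law.

(** * The Gaussian tail *)

Section normal_tail.
Context {R : realType}.
Local Notation mu := (@lebesgue_measure R).

Lemma is_derive_normal_pdf (s x : R) : s != 0 ->
  is_derive x 1 (normal_pdf 0 s : R -> R) (- (x / s ^+ 2) * normal_pdf 0 s x).
Proof.
move=> s0; rewrite normal_pdfE// /normal_fun.
have -> : (fun y : R => normal_peak s * expR (- (y - 0) ^+ 2 / (s ^+ 2 *+ 2))) =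
    (fun y : R => normal_peak s * expR (- (s ^+ 2 *+ 2)^-1 * y ^+ 2)).
  by apply/funext => y; rewrite subr0 !mulNr [((s ^+ 2 *+ 2)^-1 * _)]mulrC.
apply: is_derive_eq.
have -> : - (x - 0) ^+ 2 / (s ^+ 2 *+ 2) = - (s ^+ 2 *+ 2)^-1 * x ^+ 2.
  by rewrite subr0 !mulNr mulrC.
by rewrite /GRing.scale/=; field.
Qed.

Lemma cvg_normal_pdf_y (s : R) : s != 0 ->
  normal_pdf 0 s x @[x --> +oo] --> (0 : R).
Proof.
move=> s0; have k0 : 0 < (Num.sqrt (s ^+ 2 *+ 2))^-1.
  by rewrite invr_gt0 sqrtr_gt0 pmulrn_lgt0// exprn_even_gt0.
rewrite normal_pdfE//.
have -> : (fun x : R => normal_peak s * normal_fun 0 s x) =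
    (fun x : R => normal_peak s * gauss_fun (x * (Num.sqrt (s ^+ 2 *+ 2))^-1)).
  apply/funext => x; congr (_ * expR _); rewrite subr0 exprMn exprVn mulNr.
  by rewrite sqr_sqrtr// mulrn_wge0// sqr_ge0.
rewrite -(mulr0 (normal_peak s)); apply: cvgM; first exact: cvg_cst.
apply: (cvg_comp (fun x => x * (Num.sqrt (s ^+ 2 *+ 2))^-1) (@gauss_fun R)).
  by apply: gt0_cvgMly => //; exact: cvg_id.
exact: cvg_gauss_fun.
Qed.

(** An antiderivative of x times the density is - s ^ 2 times the density, which
    vanishes at infinity. *)
Lemma integral_id_normal_pdf (s a : R) : s != 0 -> 0 <= a ->
  (\int[mu]_(x in `[a, +oo[) (x * normal_pdf 0 s x)%:E =
  (s ^+ 2 * normal_pdf 0 s a)%:E)%E.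
Proof.
move=> s0 a0.
rewrite (@ge0_continuous_FTC2y _ _ (fun x => - s ^+ 2 * normal_pdf 0 s x) a 0).
- by rewrite sub0e -EFinN mulNr opprK.
- by move=> x ax; rewrite mulr_ge0 ?normal_pdf_ge0 ?(le_trans a0).
- apply: continuous_subspaceT => x.
  by apply: cvgM; [exact: cvg_id|exact: continuous_normal_pdf].
- rewrite -[X in _ --> X](mulr0 (- s ^+ 2)); apply: cvgM; first exact: cvg_cst.
  exact: cvg_normal_pdf_y.
- move=> x _; apply: ex_derive; apply: is_deriveZ; exact: is_derive_normal_pdf.
- apply: cvg_at_right_filter; apply: cvgM; first exact: cvg_cst.
  exact: continuous_normal_pdf.
- move=> x _; rewrite derive1E.
  have := is_derive_normal_pdf x s0 => ?.
  by rewrite derive_val /GRing.scale/=; field.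
Qed.

Lemma normal_prob_itv_le (i : interval R) (s a : R) : 0 < a ->
  (forall x, x \in i -> a <= x) ->
  (normal_prob 0 s [set` i] <=
    \int[mu]_(x in [set` i]) (x / a * normal_pdf 0 s x)%:E)%E.
Proof.
move=> a0 ai; apply: ge0_le_integral => //.
- by move=> x _; rewrite lee_fin normal_pdf_ge0.
- apply/measurable_EFinP; apply: measurable_funTS.
  exact: measurable_normal_pdf.
- apply/measurable_EFinP; apply: measurable_funM.
    exact: measurable_funM.
  by apply: measurable_funTS; exact: measurable_normal_pdf.
- move=> x /= xi; rewrite lee_fin.
  by rewrite ler_peMl ?normal_pdf_ge0// ler_pdivlMr// mul1r ai.
Qed.

Lemma integral_scaled_id_normal_pdf (s a c : R) : s != 0 -> 0 < a -> 0 <= c ->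
  (\int[mu]_(x in `[c, +oo[) (x / a * normal_pdf 0 s x)%:E =
  (s ^+ 2 / a * normal_pdf 0 s c)%:E)%E.
Proof.
move=> s0 a0 c0.
under eq_integral do rewrite mulrAC mulrC EFinM.
rewrite ge0_integralZl//; first last.
- by rewrite lee_fin invr_ge0 ltW.
- move=> x /=; rewrite in_itv/= andbT => cx.
  by rewrite lee_fin mulr_ge0 ?normal_pdf_ge0// (le_trans c0).
- apply/measurable_EFinP; apply: measurable_funM => //.
  by apply: measurable_funTS; exact: measurable_normal_pdf.
rewrite integral_id_normal_pdf// -EFinM; congr _%:E.
by rewrite mulrA [X in X * _]mulrC.
Qed.

(** Bounding 1 by x / a on the whole half-line only gives the weak inequality.
    Strictness comes from the part beyond b = a + 1, where 1 can be bounded by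
    x / b instead. *)
Lemma normal_prob_itvcy_lt (s a : R) : s != 0 -> 0 < a ->
  (normal_prob 0 s `[a, +oo[ < (s ^+ 2 / a * normal_pdf 0 s a)%:E)%E.
Proof.
move=> s0 a0.
pose b := a + 1.
have ab : a < b by rewrite ltrDl.
have b0 : 0 < b by rewrite addr_gt0.
have split_ab : `[a, +oo[%classic = `[a, b[%classic `|` `[b, +oo[%classic.
  by rewrite -itv_bndbnd_setU// bnd_simp ltW.
have dis_ab : [disjoint `[a, b[%classic & `[b, +oo[%classic].
  apply/disj_setPS => x [/=]; rewrite !in_itv/= => /andP[_ xb] /andP[bx _].
  by move: (lt_le_trans xb bx); rewrite ltxx.
rewrite -(integral_scaled_id_normal_pdf s0 a0 (ltW a0)) split_ab.
rewrite measureU//=; last exact/disj_set2P.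
rewrite ge0_integral_setU//=; first last.
- move=> x abx; have : `[a, +oo[%classic x by rewrite split_ab.
  rewrite /= in_itv/= andbT => ax.
  by rewrite lee_fin mulr_ge0 ?normal_pdf_ge0// divr_ge0 ?(ltW a0)//
    (le_trans (ltW a0) ax).
- apply/measurable_EFinP; apply: measurable_funM.
    exact: measurable_funM.
  by apply: measurable_funTS; exact: measurable_normal_pdf.
rewrite (integral_scaled_id_normal_pdf s0 a0 (ltW b0)).
apply: lee_ltD.
- exact: fin_num_measure.
- apply: normal_prob_itv_le => // x.
  by rewrite in_itv/= => /andP[].
- apply: (@le_lt_trans _ _ (s ^+ 2 / b * normal_pdf 0 s b)%:E).
  rewrite -(integral_scaled_id_normal_pdf s0 b0 (ltW b0)).
    apply: normal_prob_itv_le => // x.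
    by rewrite in_itv/= andbT.
  rewrite lte_fin ltr_pM2r; last first.
    by rewrite normal_pdfE// mulr_gt0 ?normal_peak_gt0 ?expR_gt0.
  by rewrite ltr_pM2l ?exprn_even_gt0// ltf_pV2 ?posrE.
Qed.

Lemma normal_prob_symmetric (s : R) (B : set R) : s != 0 -> measurable B ->
  normal_prob 0 s (-%R @^-1` B) = normal_prob 0 s B.
Proof.
move=> s0 mB.
have -> : -%R @^-1` B = (fun x : R => (-1) * x) @^-1` B.
  by apply/funext => x; rewrite /preimage/= mulN1r.
rewrite normal_prob_scale ?oppr_eq0 ?oner_eq0// mulN1r.
rewrite /normal_prob; apply: eq_integral => x _; congr _%:E.
by rewrite !normal_pdf0E ?oppr_eq0// sqrrN.
Qed.

Lemma normal_prob_abs_ge_lt (s a : R) : s != 0 -> 0 < a ->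
  (normal_prob 0 s [set x : R | (a <= `|x|)%R] <
   (2 * s ^+ 2 / a * normal_pdf 0 s a)%:E)%E.
Proof.
move=> s0 a0.
have -> : [set x : R | a <= `|x|] =
    `[a, +oo[%classic `|` -%R @^-1` `[a, +oo[%classic.
  by apply/seteqP; split => x /=; rewrite !in_itv/= !andbT ler_normr => /orP.
have mN : measurable (-%R @^-1` `[a, +oo[%classic : set R).
  by rewrite -[X in measurable X]setTI; exact: oppr_measurable.
apply: (@le_lt_trans _ _ (normal_prob 0 s `[a, +oo[ +
  normal_prob 0 s (-%R @^-1` `[a, +oo[))%E).
  exact: measureU2.
rewrite normal_prob_symmetric//.
have -> : 2 * s ^+ 2 / a * normal_pdf 0 s a =
  s ^+ 2 / a * normal_pdf 0 s a + s ^+ 2 / a * normal_pdf 0 s a by ring.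
by rewrite EFinD; apply: lteD; exact: normal_prob_itvcy_lt.
Qed.

End normal_tail.

(** * Linear combinations of white Gaussian noise *)

Section gaussian_combination.
Context d (T : measurableType d) (R : realType) (P : probability T R).

Lemma eq_normal_prob0 (s s' : R) (B : set R) : s != 0 -> s ^+ 2 = s' ^+ 2 ->
  normal_prob 0 s B = normal_prob 0 s' B.
Proof.
move=> s0 ss'; have s'0 : s' != 0 by rewrite -sqrf_eq0 -ss' sqrf_eq0.
rewrite /normal_prob; apply: eq_integral => x _; congr _%:E.
by rewrite !normal_pdf0E// ss'.
Qed.

Lemma normal_prob_add (u v : R) (p : {nonneg R})
    (nu : {measure set (measurableTypeR R * measurableTypeR R) -> \bar R})
    (D : set R) :
  u != 0 -> v != 0 -> measurable D ->
  (forall A B, measurable A -> measurable B ->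
    nu (A `*` B) = normal_prob 0 u A * (p%:num%:E * normal_prob 0 v B))%E ->
  nu [set xy | D (xy.1 + xy.2)] =
  (p%:num%:E * normal_prob 0 (Num.sqrt (u ^+ 2 + v ^+ 2)) D)%E.
Proof.
move=> u0 v0 mD nuE.
have mS := measurable_preimage_add mD.
rewrite -(@product_measure_unique _ _ _ _ R (normal_prob 0 u)
  (mscale p (normal_prob 0 v)) nu nuE _ mS).
rewrite -normal_prob_convolution// /product_measure1 -ge0_integralZl//.
exact: measurable_fun_xsection.
Qed.

(** The event E stands for constraints on further variables. Keeping it in the
    statement is what lets sums of more than two variables be treated one
    variable at a time, without a separate proof that a partial sum is
    independent of the variables left out. The number p is the probability of
    E. *)
Lemma law_sum_indep (u v : R) (p : {nonneg R}) (X Y : T -> R) (E : set T)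
    (D : set R) :
  u != 0 -> v != 0 -> measurable E -> measurable D ->
  measurable_fun setT X -> measurable_fun setT Y ->
  (forall A B, measurable A -> measurable B ->
    P [set t | [/\ A (X t), B (Y t) & E t]] =
    normal_prob 0 u A * (p%:num%:E * normal_prob 0 v B))%E ->
  P [set t | D (X t + Y t) /\ E t] =
  (p%:num%:E * normal_prob 0 (Num.sqrt (u ^+ 2 + v ^+ 2)) D)%E.
Proof.
move=> u0 v0 mE mD mX mY XY.
pose f t : measurableTypeR R * measurableTypeR R := (X t, Y t).
have mf : measurable_fun [set: T] f by exact: measurable_fun_pair.
pose mf' := isMeasurableFun.Build _ _ _ _ _ mf.
pose F : {mfun T >-> (measurableTypeR R * measurableTypeR R)%type} :=
  HB.pack f mf'.
rewrite -(@normal_prob_add u v p (pushforward (mrestr P mE) F) D)//.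
move=> A B mA mB; rewrite -XY// /pushforward /mrestr.
by congr (P _); apply/seteqP; split => t /=; [case=> -[]|case].
Qed.

Lemma law_scale (sigma a : R) (X : {RV P >-> R}) (A : set R) :
  sigma != 0 -> a != 0 -> measurable A ->
  (forall B, measurable B -> distribution P X B = normal_prob 0 sigma B) ->
  P (X @^-1` ((fun z => a * z) @^-1` A)) = normal_prob 0 (a * sigma) A.
Proof.
move=> s0 a0 mA lawX; rewrite -normal_prob_scale// -lawX//.
exact: measurable_preimage_mul.
Qed.

(** The free events C on the coordinates in K carry the independence through the
    induction on r: to add the coordinate x, the induction hypothesis is used
    with x put into K. *)
Lemma law_partial_sum n (sigma : R) (w : 'I_n -> {RV P >-> R}) (a : 'I_n -> R)
    (x : 'I_n) (r : seq 'I_n) (K : {set 'I_n}) (C : 'I_n -> set R) (B : set R) :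
  sigma != 0 -> white_gaussian sigma w ->
  uniq (x :: r) -> {in x :: r, forall i, a i != 0 /\ i \notin K} ->
  (forall i, measurable (C i)) -> measurable B ->
  P [set t | B (\sum_(i <- x :: r) a i * w i t) /\
             forall k, k \in K -> C k (w k t)] =
  ((\prod_(k in K) P (w k @^-1` C k)) *
   normal_prob 0 (Num.sqrt (\sum_(i <- x :: r) (a i * sigma) ^+ 2)) B)%E.
Proof.
move=> s0 [wind wlaw].
(* A constraint on the next summand a x * w x is itself an event about the
   coordinate x, hence can join the family C. *)
pose adjoin x A (C : 'I_n -> set R) k :=
  if k == x then (fun z => a x * z) @^-1` A else C k.
have m_adjoin x' A C' : measurable A -> (forall i, measurable (C' i)) ->
    forall i, measurable (adjoin x' A C' i).
  move=> mA mC i; rewrite /adjoin; case: ifP => // _.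
  exact: measurable_preimage_mul.
have adjoinE x' A C' (K' : {set 'I_n}) t : x' \notin K' ->
    (forall k, k \in x' |: K' -> adjoin x' A C' k (w k t)) <->
    (A (a x' * w x' t) /\ forall k, k \in K' -> C' k (w k t)).
  move=> x'K; split => [h|[h1 h2] k].
    split=> [|k kK].
      by have := h x'; rewrite setU11 /adjoin eqxx; exact.
    have := h k; rewrite in_setU1 kK orbT /adjoin ifN; first exact.
    by apply: contraNneq x'K => <-.
  rewrite in_setU1 /adjoin; case: eqP => [-> _ //|_ /= kK]; exact: h2.
have prod_adjoin x' A C' (K' : {set 'I_n}) : x' \notin K' -> a x' != 0 ->
    measurable A ->
    (\prod_(k in (x' |: K')%SET) P (w k @^-1` adjoin x' A C' k) =
     normal_prob 0 (a x' * sigma) A * \prod_(k in K') P (w k @^-1` C' k))%E.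
  move=> x'K ax mA; rewrite big_setU1//= {1}/adjoin eqxx; congr (_ * _)%E.
    exact: (law_scale s0 ax mA (wlaw x')).
  apply: eq_bigr => k kK; rewrite /adjoin ifN//.
  by apply: contraNneq x'K => <-.
elim: r x K C B => [|y r IH] x K C B ur aK mC mB.
  have [ax xK] := aK x (mem_head _ _).
  under eq_set do rewrite big_seq1.
  rewrite big_seq1 muleC.
  rewrite (@eq_normal_prob0 _ (a x * sigma)); first last.
  - by rewrite sqr_sqrtr ?sqr_ge0.
  - by rewrite sqrtr_sqr normr_eq0 mulf_neq0.
  rewrite -prod_adjoin// -wind.
    by congr (P _); apply/seteqP; split => t /= /adjoinE; apply.
  exact: m_adjoin.
have [ax xK] := aK x (mem_head _ _).
move: ur => /= /andP[xyr ur].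
under eq_set do rewrite big_cons.
pose E := [set t | forall k, k \in K -> C k (w k t)].
have mE : measurable E.
  apply: measurable_forall => k; apply: measurable_implies.
    exact: measurable_cst_prop.
  by rewrite -[X in measurable X]setTI; apply: (measurable_funPT (w k)).
have p0 : 0 <= fine (\prod_(k in K) P (w k @^-1` C k))%E.
  by rewrite fine_ge0// prode_ge0.
have pE : ((NngNum p0)%:num%:E = \prod_(k in K) P (w k @^-1` C k))%E.
  rewrite /= fineK// prode_fin_num// => k _; rewrite fin_num_measure//.
  by rewrite -[X in measurable X]setTI; apply: (measurable_funPT (w k)).
pose v := Num.sqrt (\sum_(i <- y :: r) (a i * sigma) ^+ 2).
have v2 : v ^+ 2 = \sum_(i <- y :: r) (a i * sigma) ^+ 2.
  by rewrite sqr_sqrtr// sumr_ge0// => i _; rewrite sqr_ge0.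
have v0 : v != 0.
  have [ay _] : a y != 0 /\ y \notin K by apply: aK; rewrite !inE eqxx orbT.
  rewrite -sqrf_eq0 v2 big_cons gt_eqF// ltr_wpDr//.
    by rewrite sumr_ge0// => i _; rewrite sqr_ge0.
  by rewrite exprn_even_gt0//= mulf_neq0.
rewrite [in RHS]big_cons -v2 -pE.
apply: (@law_sum_indep (a x * sigma) v _ (fun t => a x * w x t)
  (fun t => \sum_(i <- y :: r) a i * w i t) E) => //.
- exact: mulf_neq0.
- exact: measurable_funM.
- by apply: measurable_sum => i; exact: measurable_funM.
move=> A B' mA mB'.
have yrK : {in y :: r, forall i, a i != 0 /\ i \notin x |: K}.
  move=> i iyr; have [ai iK] : a i != 0 /\ i \notin K.
    by apply: aK; rewrite inE iyr orbT.
  split => //; rewrite in_setU1 negb_or iK andbT.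
  by apply: contraNneq xyr => <-.
have := IH y (x |: K)%SET (adjoin x A C) B' ur yrK (m_adjoin _ _ _ mA mC) mB'.
rewrite pE prod_adjoin// -muleA => <-.
congr (P _); apply/seteqP; split => t /=.
  by move=> [At Bt Et]; split => //; apply/(adjoinE _ _ _ _ _ xK).
by move=> [Bt /adjoinE h]; have [] := h xK.
Qed.

(** Rotation invariance of white noise, one direction at a time. *)
Lemma law_combination n (sigma : R) (w : 'I_n -> {RV P >-> R}) (a : 'I_n -> R)
    (B : set R) :
  0 < sigma -> white_gaussian sigma w -> \sum_i a i ^+ 2 = 1 -> measurable B ->
  P [set t | B (\sum_i a i * w i t)] = normal_prob 0 sigma B.
Proof.
move=> s0 wg a1 mB.
(* A zero coefficient would contribute a Dirac mass, which is not of the form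
   normal_prob 0 s. *)
pose r := [seq i <- index_enum 'I_n | a i != 0].
have sumr (F : 'I_n -> R) : (forall i, a i = 0 -> F i = 0) ->
    \sum_i F i = \sum_(i <- r) F i.
  move=> F0; rewrite big_filter [RHS]big_mkcond; apply: eq_bigr => i _.
  by case: eqP => // /F0.
have ur : uniq r by rewrite filter_uniq// index_enum_uniq.
have ar i : i \in r -> a i != 0 by rewrite mem_filter => /andP[].
have a2r : \sum_(i <- r) a i ^+ 2 = 1.
  by rewrite -sumr// => i ->; rewrite expr0n.
have sumw t : \sum_i a i * w i t = \sum_(i <- r) a i * w i t.
  by apply: sumr => i ->; rewrite mul0r.
under eq_set do rewrite sumw.
case: r ur ar a2r {sumr sumw} => [|x r] ur ar a2r.
  by move/eqP: a2r; rewrite big_nil eq_sym oner_eq0.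
have -> : normal_prob 0 sigma B =
    normal_prob 0 (Num.sqrt (\sum_(i <- x :: r) (a i * sigma) ^+ 2)) B.
  congr (normal_prob _ _ _); under eq_bigr do rewrite exprMn.
  by rewrite -mulr_suml a2r mul1r sqrtr_sqr gtr0_norm.
have axr : {in x :: r, forall i,
    a i != 0 /\ i \notin (finset.set0 : {set 'I_n})}.
  by move=> i /ar; rewrite finset.in_set0.
have s0' : sigma != 0 by rewrite gt_eqF.
have := law_partial_sum s0' wg ur axr (fun _ => measurableT) mB.
rewrite big_set0 mul1e => <-; congr (P _).
by apply/seteqP; split => t /=; [split|case].
Qed.
End gaussian_combination.

(** * Coherence and least squares *)

Section coherence.
Variables (R : realType) (n m : nat) (A : 'M[R]_(n, m)).
Local Notation mu := (coherence A).

Lemma dotE (u v : 'cV[R]_n) : dot u v = \sum_i u i 0 * v i 0.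
Proof. by rewrite /dot mxE; apply: eq_bigr => i _; rewrite mxE. Qed.

Lemma dotDr (u v v' : 'cV[R]_n) : dot u (v + v') = dot u v + dot u v'.
Proof. by rewrite /dot mulmxDr mxE. Qed.

Lemma dotBr (u v v' : 'cV[R]_n) : dot u (v - v') = dot u v - dot u v'.
Proof. by rewrite /dot mulmxBr !mxE. Qed.

Lemma dot_col_mulmx (j : 'I_m) (z : 'cV[R]_m) :
  dot (col j A) (A *m z) = \sum_i z i 0 * dot (col j A) (col i A).
Proof.
rewrite /dot mulmxA mxE; apply: eq_bigr => i _; rewrite mulrC; congr (_ * _).
by rewrite !mxE; apply: eq_bigr => k _; rewrite !mxE.
Qed.

Lemma dot_col_same (j : 'I_m) : norm2 (col j A) = 1 ->
  dot (col j A) (col j A) = 1.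
Proof.
move=> /(congr1 (fun x => x ^+ 2)).
rewrite /norm2 sqr_sqrtr; last by apply: sumr_ge0 => i _; exact: sqr_ge0.
by rewrite expr1n dotE => <-; apply: eq_bigr => i _; rewrite expr2.
Qed.

Lemma coherence_ge0 : 0 <= mu.
Proof. exact: bigmax_ge_id. Qed.

Lemma dot_col_le_coherence (i j : 'I_m) : i != j ->
  `|dot (col i A) (col j A)| <= mu.
Proof.
move=> ij; rewrite /coherence.
apply: le_trans (le_bigmax _ _ i) => /=.
apply: (le_bigmax_cond _ (fun j => `|dot (col i A) (col j A)|)).
by rewrite eq_sym.
Qed.

Hypothesis unit_cols : forall i, norm2 (col i A) = 1.

(** Correlating a superposition of columns with the j-th column recovers the
    j-th coefficient up to one cross term per other active column. *)
Lemma interference_le (S : {set 'I_m}) (z : 'cV[R]_m) (M : R) (j : 'I_m) :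
  (forall i, i \notin S -> z i 0 = 0) -> (forall i, `|z i 0| <= M) ->
  `|dot (col j A) (A *m z) - z j 0| <= #|S :\ j|%:R * (M * mu).
Proof.
move=> zS zM; rewrite dot_col_mulmx (bigD1 j)//= dot_col_same// mulr1.
rewrite addrAC subrr add0r.
apply: le_trans (ler_norm_sum _ _ _) _.
rewrite (bigID (mem S))/= [X in _ + X]big1 ?addr0; last first.
  by move=> i /andP[_ /zS ->]; rewrite mul0r normr0.
rewrite -sum1_card natr_sum mulr_suml.
rewrite (eq_bigl (mem (S :\ j))); last by move=> i; rewrite !inE.
apply: ler_sum => i /setD1P[ij iS]; rewrite mul1r normrM.
by apply: ler_pM => //; apply: dot_col_le_coherence; rewrite eq_sym.
Qed.

Lemma noisy_interference_lt (S : {set 'I_m}) (z : 'cV[R]_m) (w : 'cV[R]_n)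
    (M tau : R) (j : 'I_m) :
  (forall i, i \notin S -> z i 0 = 0) -> (forall i, `|z i 0| <= M) ->
  `|dot (col j A) w| < tau ->
  `|dot (col j A) (A *m z + w) - z j 0| < #|S :\ j|%:R * (M * mu) + tau.
Proof.
move=> zS zM wj; rewrite dotDr addrAC.
apply: le_lt_trans (ler_normD _ _) _.
by apply: ler_ltD => //; exact: interference_le.
Qed.

Lemma support_correlation_gt (S : {set 'I_m}) (s : nat) (z : 'cV[R]_m)
    (w : 'cV[R]_n) (M tau : R) (i : 'I_m) : #|S| = s ->
  (forall k, k \notin S -> z k 0 = 0) -> (forall k, `|z k 0| <= M) ->
  `|dot (col i A) w| < tau -> i \in S ->
  `|z i 0| - (s%:R - 1) * mu * M - tau < `|dot (col i A) (A *m z + w)|.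
Proof.
move=> cS zS zM wi iS.
have := noisy_interference_lt zS zM wi.
have -> : #|S :\ i|%:R = s%:R - 1 :> R.
  by rewrite -cS (cardsD1 i S) iS natrD addrAC subrr add0r.
have := lerB_dist (z i 0) (z i 0 - dot (col i A) (A *m z + w)).
rewrite subKr distrC.
by set x := `|_ - _|; lra.
Qed.

Lemma off_support_correlation_lt (S : {set 'I_m}) (s : nat) (z : 'cV[R]_m)
    (w : 'cV[R]_n) (M tau : R) (j : 'I_m) : #|S| = s ->
  (forall k, k \notin S -> z k 0 = 0) -> (forall k, `|z k 0| <= M) ->
  `|dot (col j A) w| < tau -> j \notin S ->
  `|dot (col j A) (A *m z + w)| < s%:R * mu * M + tau.
Proof.
move=> cS zS zM wj jS; have := noisy_interference_lt zS zM wj.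
have -> : S :\ j = S.
  apply/finset.setP => k; rewrite !inE.
  by case: eqP => // ->; rewrite (negbTE jS).
by rewrite zS// subr0 cS -mulrA [mu * M]mulrC.
Qed.

(** Of the 2 s - 1 cross terms, s - 1 can lower the correlation of a column of
    the support and s can raise that of a column outside it; each of the two
    also suffers a noise term. *)
Lemma support_correlation_dominates (S : {set 'I_m}) (s : nat) (z : 'cV[R]_m)
    (w : 'cV[R]_n) (M tau : R) (i j : 'I_m) : #|S| = s ->
  (forall k, k \notin S -> z k 0 = 0) -> (forall k, `|z k 0| <= M) ->
  (forall k, `|dot (col k A) w| < tau) ->
  2 * tau <= `|z i 0| - (2 * s%:R - 1) * mu * M -> i \in S -> j \notin S ->
  `|dot (col j A) (A *m z + w)| < `|dot (col i A) (A *m z + w)|.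
Proof.
move=> cS zS zM wt hi iS jS.
have := support_correlation_gt cS zS zM (wt i) iS.
have := off_support_correlation_lt cS zS zM (wt j) jS.
lra.
Qed.

End coherence.

Section least_squares.
Variables (R : realType) (n m : nat) (A : 'M[R]_(n, m)).

Lemma ls_estimate_notin (b : 'cV[R]_n) (L : {set 'I_m}) (i : 'I_m) :
  i \notin L -> ls_estimate A b L i 0 = 0.
Proof.
move=> iL; rewrite mxE big1// => k /eqP ki; move: iL.
by rewrite -ki enum_valP.
Qed.

Lemma ls_estimate_set0 (b : 'cV[R]_n) : ls_estimate A b finset.set0 = 0.
Proof.
by apply/colP => i; rewrite ls_estimate_notin ?finset.in_set0// mxE.
Qed.

Lemma mulmx_ls_estimate (b : 'cV[R]_n) (L : {set 'I_m}) :
  A *m ls_estimate A b L = submx_cols A L *m (Defs.pinv (submx_cols A L) *m b).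
Proof.
apply/colP => i; rewrite !mxE.
under eq_bigr do rewrite mxE mulr_sumr.
rewrite (exchange_big_dep predT)//=; apply: eq_bigr => k _.
by rewrite (big_pred1 (enum_val k))// [submx_cols _ _ _ _]mxE.
Qed.

(** The normal equations, which follow from the Penrose identities
    M X M = M and (M X)^T = M X. *)
Lemma ls_residual_orthogonal (b : 'cV[R]_n) (L : {set 'I_m}) (j : 'I_m) :
  j \in L -> dot (col j A) (b - A *m ls_estimate A b L) = 0.
Proof.
move=> jL; rewrite mulmx_ls_estimate.
set M := submx_cols A L; have [M1 _ M3 _] := Defs.pinvP M.
have -> : col j A = col (enum_rank_in jL j) M.
  by apply/colP => i; rewrite !mxE enum_rankK_in.
have normal_eq : M^T *m (b - M *m (Defs.pinv M *m b)) = 0.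
  by rewrite mulmxBr !mulmxA -[M^T *m M *m _]mulmxA -M3 -trmx_mul M1 subrr.
rewrite /dot -[X in X *m _](_ : row (enum_rank_in jL j) M^T = _); last first.
  by rewrite tr_col.
by rewrite -row_mul normal_eq !mxE.
Qed.

End least_squares.

(** * Deterministic support recovery *)

Section support_recovery.
Variables (R : realType) (n m : nat) (A : 'M[R]_(n, m)).
Hypothesis unit_cols : forall i, norm2 (col i A) = 1.
Local Notation mu := (coherence A).
Implicit Types (x : 'cV[R]_m) (w b : 'cV[R]_n).

Lemma le_max_abs x i : `|x i 0| <= max_abs x.
Proof.
have [xi0|xi] := eqVneq (x i 0) 0; first by rewrite xi0 normr0 bigmax_ge_id.
by apply: (le_bigmax_cond _ (fun i => `|x i 0|)); rewrite inE.
Qed.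

Lemma min_abs_le x i : i \in supp x -> min_abs x <= `|x i 0|.
Proof. by move=> ix; exact: (bigmin_le_cond _ (fun i => `|x i 0|)). Qed.

Lemma supp_neq0 x : x != 0 -> exists i, i \in supp x.
Proof. by move=> /cV0Pn[i xi]; exists i; rewrite inE. Qed.

Lemma min_abs_gt0 x : x != 0 -> 0 < min_abs x.
Proof.
move=> /supp_neq0[i ix]; apply/bigmin_gtP; split.
  by apply: lt_le_trans (le_max_abs x i); rewrite normr_gt0; rewrite inE in ix.
by move=> j; rewrite inE normr_gt0.
Qed.

Lemma min_abs_le_max_abs x : min_abs x <= max_abs x.
Proof. exact: bigmin_le_id. Qed.

Lemma notin_supp x i : i \notin supp x -> x i 0 = 0.
Proof. by rewrite inE negbK => /eqP. Qed.

(** The error z of the estimate satisfies <a_i, A z> = <a_i, w> for i in S. At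
    an entry i of largest modulus, interference bounds |z i| by
    tau + (|S| - 1) mu |z i|. *)
Lemma ls_error_entry_le x w (tau : R) (S : {set 'I_m}) j :
  supp x \subset S ->
  (forall k, `|dot (col k A) w| <= tau) -> 0 < 1 - (#|S|%:R - 1) * mu ->
  `|(ls_estimate A (A *m x + w) S - x) j 0| <= tau / (1 - (#|S|%:R - 1) * mu).
Proof.
move=> xS wt c0; set z := _ - x.
have zS k : k \notin S -> z k 0 = 0.
  move=> kS; rewrite !mxE; apply/eqP; rewrite subr_eq0.
  have := ls_estimate_notin A (A *m x + w) kS; rewrite mxE => ->.
  by rewrite notin_supp//; apply: contraNN kS; exact: (fintype.subsetP xS).
have [i _ imax] := @Order.TotalTheory.arg_maxP _ _ _ j xpredT
  (fun k => `|z k 0|) isT.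
apply: le_trans (imax j isT) _; rewrite ler_pdivlMr//.
have tau0 : 0 <= tau by apply: le_trans (wt j).
have [iS|/zS ->] := boolP (i \in S); last by rewrite normr0 mul0r.
have Az : dot (col i A) (A *m z) = dot (col i A) w.
  have := ls_residual_orthogonal A (A *m x + w) iS.
  rewrite mulmxBr !dotBr dotDr; lra.
have := interference_le unit_cols i zS (fun k => imax k isT).
have := cardsD1 i S; rewrite iS => /(congr1 (fun k => k%:R : R)).
rewrite natrD /= => ->; rewrite Az.
have := wt i; have := lerB_dist (z i 0) (z i 0 - dot (col i A) w).
by rewrite subKr [`|z i 0 - dot _ _|]distrC; lra.
Qed.

(** Going through the largest entry gives the same constant as an estimate of
    the least eigenvalue of the Gram matrix. *)
Lemma ls_error_le x w (tau : R) (S : {set 'I_m}) :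
  supp x \subset S ->
  (forall k, `|dot (col k A) w| <= tau) -> 0 < 1 - (#|S|%:R - 1) * mu ->
  norm2 (ls_estimate A (A *m x + w) S - x) ^+ 2 <=
  #|S|%:R * (tau / (1 - (#|S|%:R - 1) * mu)) ^+ 2.
Proof.
move=> xS wt c0; set z := _ - x.
rewrite /norm2 sqr_sqrtr ?sumr_ge0//; last by move=> i _; rewrite sqr_ge0.
rewrite (bigID (mem S))/= [X in _ + X]big1 ?addr0; last first.
  move=> i iS; rewrite !mxE.
  have := ls_estimate_notin A (A *m x + w) iS; rewrite mxE => ->.
  rewrite notin_supp ?subr0 ?expr0n//.
  by apply: contraNN iS; exact: (fintype.subsetP xS).
rewrite mulr_natl -sumr_const; apply: ler_sum => i _.
have zi := ls_error_entry_le i xS wt c0.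
by rewrite -[leLHS]real_normK ?num_real// ler_sqr ?nnegrE// (le_trans _ zi).
Qed.

Lemma threshold_recovers x w (tau : R) (L : {set 'I_m}) :
  (forall k, `|dot (col k A) w| < tau) ->
  2 * tau <= min_abs x - (2 * (norm0 x)%:R - 1) * mu * max_abs x ->
  threshold_support A (A *m x + w) (norm0 x) L -> L = supp x.
Proof.
move=> wt h []; rewrite /norm0 => cL Lmax; apply/esym/eqP.
rewrite eqEcard cL leqnn andbT.
apply/fintype.subsetP => i ix; apply: contraT => iL.
have [j jL jx] : exists2 j, j \in L & j \notin supp x.
  apply/subsetPn; apply: contraNN iL => Lx.
  by have /eqP -> : L == supp x by rewrite eqEcard Lx cL leqnn.
have := Lmax _ _ jL iL; rewrite leNgt => /negP[].
apply: (support_correlation_dominates unit_cols (erefl (norm0 x))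
  (M := max_abs x) _ _ wt _ ix jx).
- by move=> k; exact: notin_supp.
- exact: le_max_abs.
- by apply: le_trans h _; rewrite lerD2r min_abs_le.
Qed.

Lemma omp_state_ls b i L xh r : omp_state A b i L xh r ->
  xh = ls_estimate A b L /\ r = b - A *m xh.
Proof. by case=> //; rewrite ls_estimate_set0 mulmx0 subr0. Qed.

(** While some index l of the support is missing, the vector z = x - xh has an
    entry at least as large as min_abs x, namely z l = x l. The residual is
    A z + w, so the comparison of correlations applies to z with its own
    largest entry in place of max_abs x: this is why a condition on min_abs x
    alone suffices. The selected index is new because the residual is
    orthogonal to the columns selected before. *)
Lemma omp_state_support x w (tau : R) i L xh r :
  (forall k, `|dot (col k A) w| < tau) -> x != 0 ->
  2 * tau <= min_abs x - (2 * (norm0 x)%:R - 1) * mu * min_abs x ->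
  omp_state A (A *m x + w) i L xh r -> (i <= norm0 x)%N ->
  L \subset supp x /\ #|L| = i.
Proof.
move=> wt x0 h; elim => [_|{i L xh r} i L xh r k H IH kmax ix].
  by rewrite finset.sub0set cards0.
have [Lx cL] := IH (ltnW ix).
have [xhE rE] := omp_state_ls H.
have xmin0 := min_abs_gt0 x0.
have [i0 _] := supp_neq0 x0.
have tau0 : 0 < tau by apply: le_lt_trans (wt i0).
pose z := x - xh.
have rz : r = A *m z + w by rewrite rE /z mulmxBr addrAC.
have zS j : j \notin supp x -> z j 0 = 0.
  move=> jx; rewrite !mxE xhE ls_estimate_notin ?notin_supp ?subr0//.
  by apply: contraNN jx; exact: (fintype.subsetP Lx).
have [l lx lL] : exists2 l, l \in supp x & l \notin L.
  apply/subsetPn; apply: contraL ix => /subset_leq_card.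
  by rewrite cL -leqNgt.
have zl : z l 0 = x l 0 by rewrite !mxE xhE ls_estimate_notin ?subr0.
have [q _ qmax] := @Order.TotalTheory.arg_maxP _ _ _ l xpredT
  (fun j => `|z j 0|) isT.
have zqmin : min_abs x <= `|z q 0|.
  by apply: le_trans (qmax l isT); rewrite zl min_abs_le.
have qx : q \in supp x.
  by apply: contraTT zqmin => /zS ->; rewrite normr0 -ltNge.
(* The margin is proportional to the size of the entries, hence can only grow
   from min_abs x to |z q|. *)
have hq : 2 * tau <= `|z q 0| - (2 * (norm0 x)%:R - 1) * mu * `|z q 0|.
  have c0 : 0 <= 1 - (2 * (norm0 x)%:R - 1) * mu.
    have : 0 <= min_abs x * (1 - (2 * (norm0 x)%:R - 1) * mu) by lra.
    by rewrite pmulr_rge0.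
  have := ler_wpM2r c0 zqmin; lra.
have kx : k \in supp x.
  apply: contraT => kx; have := kmax q; rewrite leNgt => /negP[]; rewrite rz.
  exact: (support_correlation_dominates unit_cols (erefl (norm0 x)) zS
    (fun j => qmax j isT) wt hq qx kx).
have kL : k \notin L.
  apply: contraT; rewrite negbK => kL.
  have := kmax q; rewrite {2}rE xhE ls_residual_orthogonal// normr0 leNgt.
  move=> /negP[]; rewrite rz.
  apply: le_lt_trans (support_correlation_gt unit_cols (erefl (norm0 x)) zS
    (fun j => qmax j isT) (wt q) qx).
  have : 0 <= (norm0 x)%:R * mu * `|z q 0|.
    by rewrite !mulr_ge0// coherence_ge0.
  lra.
split; last by rewrite cardsU1 kL cL.
by rewrite finset.subUset finset.sub1set kx.
Qed.

Lemma omp_recovers x w (tau : R) L xh r :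
  (forall k, `|dot (col k A) w| < tau) -> x != 0 ->
  2 * tau <= min_abs x - (2 * (norm0 x)%:R - 1) * mu * min_abs x ->
  omp_state A (A *m x + w) (norm0 x) L xh r ->
  L = supp x.
Proof.
move=> wt x0 h /(omp_state_support wt x0 h)/(_ (leqnn _))[Lx cL].
by apply/eqP; rewrite eqEcard Lx cL leqnn.
Qed.
End support_recovery.

Section accuracy.
Variables (R : realType) (n m : nat) (A : 'M[R]_(n, m)).
Hypothesis unit_cols : forall i, norm2 (col i A) = 1.
Local Notation mu := (coherence A).

Lemma norm0_ge1 (x : 'cV[R]_m) : x != 0 -> 1 <= (norm0 x)%:R :> R.
Proof.
move=> /supp_neq0[i ix]; rewrite ler1n card_gt0.
by apply/finset.set0Pn; exists i.
Qed.

(** The condition forces (2 s - 1) mu <= 1, hence 1 - (s - 1) mu >= 1 / 2, which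
    is where the factor 8 = 2 * 4 comes from. *)
Lemma oracle_ls_accurate (x : 'cV[R]_m) (w : 'cV[R]_n) (sigma a l : R) :
  x != 0 -> 0 <= a -> 0 <= l ->
  let tau := sigma * Num.sqrt (2 * a * l) in
  (forall k, `|dot (col k A) w| <= tau) ->
  2 * tau <= min_abs x - (2 * (norm0 x)%:R - 1) * mu * min_abs x ->
  norm2 (ls_estimate A (A *m x + w) (supp x) - x) ^+ 2 <=
    2 * a / (1 - ((norm0 x)%:R - 1) * mu) ^+ 2 * (norm0 x)%:R * sigma ^+ 2 * l
    <= 8 * a * (norm0 x)%:R * sigma ^+ 2 * l.
Proof.
move=> x0 a0 l0 tau wt h.
have [i0 ix] := supp_neq0 x0.
have tau0 : 0 <= tau by apply: le_trans (wt i0).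
have s1 := norm0_ge1 x0.
have mu0 := coherence_ge0 A.
set s : R := (norm0 x)%:R in h s1 *.
have c1 : 0 <= 1 - (2 * s - 1) * mu.
  have : 0 <= min_abs x * (1 - (2 * s - 1) * mu) by lra.
  by rewrite pmulr_rge0// min_abs_gt0.
pose c := 1 - (s - 1) * mu.
have c2 : 1 <= 2 * c by rewrite /c; lra.
have c0 : 0 < c by lra.
apply/andP; split.
  apply: le_trans (ls_error_le unit_cols (fintype.subxx _) wt c0) _.
  rewrite -/s -/c /tau expr_div_n exprMn sqr_sqrtr ?mulr_ge0//.
  by rewrite le_eqVlt; apply/orP; left; apply/eqP; field; rewrite gt_eqF.
rewrite -/c !ler_wpM2r ?sqr_ge0 ?(le_trans ler01 s1)//.
rewrite ler_pdivrMr ?exprn_gt0//.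
have : 1 <= (2 * c) ^+ 2 by rewrite exprn_ege1.
by move=> /(ler_wpM2l a0); lra.
Qed.
End accuracy.

(** * Measurability of the success events *)

Section measurable_success.
Context d (T : measurableType d) (R : realType) (n m : nat) (A : 'M[R]_(n, m)).
Variable b : T -> 'cV[R]_n.
Hypothesis mb : forall i, measurable_fun setT (fun t => b t i 0).

Lemma measurable_dot (u : 'cV[R]_n) (v : T -> 'cV[R]_n) :
  (forall i, measurable_fun setT (fun t => v t i 0)) ->
  measurable_fun setT (fun t => dot u (v t)).
Proof. by move=> mv; exact: measurable_mulmx_entry. Qed.

Lemma measurable_ls_estimate (L : {set 'I_m}) i :
  measurable_fun setT (fun t => ls_estimate A (b t) L i 0).
Proof.
under eq_fun do rewrite mxE -big_filter.
by apply: measurable_sum => k; exact: measurable_mulmx_entry.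
Qed.

Lemma measurable_ls_residual (L : {set 'I_m}) i :
  measurable_fun setT (fun t => (b t - A *m ls_estimate A (b t) L) i 0).
Proof.
under eq_fun do rewrite [_ i 0]mxE [X in _ + X]mxE.
apply: measurable_funB => //; apply: measurable_mulmx_entry => j.
exact: measurable_ls_estimate.
Qed.

Lemma omp_state0 (c : 'cV[R]_n) (L : {set 'I_m}) :
  (exists xh r, omp_state A c 0 L xh r) <-> L = finset.set0.
Proof.
split=> [[xh [r H]]|->]; last by exists 0, c; exact: omp_init.
by inversion H.
Qed.

(** Estimate and residual are functions of the index set, so a run of OMP is
    described by its finitely many possible index sets. *)
Lemma omp_stateS (c : 'cV[R]_n) i (L : {set 'I_m}) :
  (exists xh r, omp_state A c i.+1 L xh r) <->
  exists (L' : {set 'I_m}) (k : 'I_m), [/\ L = k |: L',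
    exists xh r, omp_state A c i L' xh r &
    forall j, `|dot (col j A) (c - A *m ls_estimate A c L')| <=
              `|dot (col k A) (c - A *m ls_estimate A c L')|].
Proof.
split.
  move=> [xh [r H]]; inversion H as [|i' L' x' r' k H' kmax]; subst.
  exists L', k; split=> //; first by exists x', r'.
  by have [<- <-] := omp_state_ls H'.
move=> [L' [k [-> [x' [r' H']] kmax]]].
have [x'E r'E] := omp_state_ls H'.
do 2 eexists; apply: (omp_step H').
by rewrite r'E x'E.
Qed.

(** For fixed L' and k, the selection rule compares measurable functions of the
    observation, and there are finitely many pairs (L', k). *)
Lemma measurable_omp_state i (L : {set 'I_m}) :
  measurable [set t | exists xh r, omp_state A (b t) i L xh r].
Proof.
elim: i L => [|i IH] L.
  under eq_set do rewrite (propext (omp_state0 _ _)).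
  exact: measurable_cst_prop.
under eq_set do rewrite (propext (omp_stateS _ _ _)).
apply: measurable_exists => L'; apply: measurable_exists => k.
rewrite [X in measurable X](_ : _ = [set _ | L = k |: L'] `&`
  ([set t | exists xh r, omp_state A (b t) i L' xh r] `&`
  [set t | forall j, `|dot (col j A) (b t - A *m ls_estimate A (b t) L')| <=
    `|dot (col k A) (b t - A *m ls_estimate A (b t) L')|])); last first.
  by apply/seteqP; split => t /= [] => [h1 h2 h3|h1 [h2 h3]]; split.
apply: measurableI; first exact: measurable_cst_prop.
apply: measurableI => //; apply: measurable_forall => j.
by apply: measurable_ler; apply: measurableT_comp => //;
  apply: measurable_dot => q; exact: measurable_ls_residual.
Qed.

Lemma measurable_threshold_support s (L : {set 'I_m}) :
  measurable [set t | threshold_support A (b t) s L].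
Proof.
apply: measurableI; first exact: measurable_cst_prop.
apply: measurable_forall => i; apply: measurable_forall => j.
apply: measurable_implies; first exact: measurable_cst_prop.
apply: measurable_implies; first exact: measurable_cst_prop.
by apply: measurable_ler; apply: measurableT_comp => //; exact: measurable_dot.
Qed.

Lemma measurable_ls_success (L S : {set 'I_m}) (x : 'cV[R]_m) (c c' : R) :
  measurable [set t |
    L = S /\ norm2 (ls_estimate A (b t) L - x) ^+ 2 <= c <= c'].
Proof.
rewrite [X in measurable X](_ : _ = [set _ | L = S /\ c <= c'] `&`
  [set t | \sum_i (ls_estimate A (b t) L i 0 - x i 0) ^+ 2 <= c]).
  apply: measurableI; first exact: measurable_cst_prop.
  apply: measurable_ler => //; apply: measurable_sum => i.
  apply: measurable_funX; apply: measurable_funB => //.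
  exact: measurable_ls_estimate.
have normE t : norm2 (ls_estimate A (b t) L - x) ^+ 2 =
    \sum_i (ls_estimate A (b t) L i 0 - x i 0) ^+ 2.
  rewrite /norm2 sqr_sqrtr; last by apply: sumr_ge0 => i _; rewrite sqr_ge0.
  by apply: eq_bigr => i _; rewrite [_ i 0]mxE [X in _ + X]mxE.
apply/seteqP; split => t /=; rewrite normE.
  by move=> [-> /andP[]].
by move=> [[-> ->] ->].
Qed.

Lemma measurable_omp_success s (S : {set 'I_m}) (x : 'cV[R]_m) (c c' : R) :
  measurable [set t | forall L xh r, omp_state A (b t) s L xh r ->
    L = S /\ norm2 (xh - x) ^+ 2 <= c <= c'].
Proof.
rewrite [X in measurable X](_ : _ = [set t | forall L,
    (exists xh r, omp_state A (b t) s L xh r) ->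
    L = S /\ norm2 (ls_estimate A (b t) L - x) ^+ 2 <= c <= c']).
  apply: measurable_forall => L; apply: measurable_implies.
    exact: measurable_omp_state.
  exact: measurable_ls_success.
apply/seteqP; split => t /= h L.
  by move=> [xh [r H]]; have [<- _] := omp_state_ls H; exact: h H.
move=> xh r H; have [-> _] := omp_state_ls H.
by apply: h; exists xh, r.
Qed.

Lemma measurable_threshold_success s (S : {set 'I_m}) (x : 'cV[R]_m)
    (c c' : R) :
  measurable [set t | forall L, threshold_support A (b t) s L ->
    L = S /\ norm2 (ls_estimate A (b t) L - x) ^+ 2 <= c <= c'].
Proof.
apply: measurable_forall => L; apply: measurable_implies.
  exact: measurable_threshold_support.
exact: measurable_ls_success.
Qed.
End measurable_success.

(** * Probability of small noise correlations *)

Section noise_bound.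
Context d (T : measurableType d) (R : realType) (P : probability T R).

Lemma union_bound (I : finType) (E : I -> set T) :
  (forall k, measurable (E k)) ->
  (P [set t | exists k, E k t] <= \sum_k P (E k))%E.
Proof.
move=> mE.
have -> : [set t | exists k, E k t] = \big[setU/set0]_k E k.
  rewrite -bigcup_seq; apply/seteqP; split => t /= [k]; last by exists k.
  by exists k => //=; exact: mem_index_enum.
elim: (index_enum I) => [|k r IH]; first by rewrite !big_nil measure0.
rewrite !big_cons; apply: le_trans (leeD2l _ IH).
by apply: measureU2 => //; exact: bigsetU_measurable.
Qed.

(** At this tau the exponent of the density is (1 + alpha) ln m, so one of the
    m ^ (1 + alpha) in the denominator cancels against the m terms of the
    union bound. *)
Lemma tail_constant (m : nat) (sigma alpha : R) : (1 < m)%N -> 0 < sigma ->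
  0 < alpha ->
  let tau := sigma * Num.sqrt (2 * (1 + alpha) * ln m%:R) in
  m%:R * (2 * sigma ^+ 2 / tau * normal_pdf 0 sigma tau) =
  1 / (m%:R `^ alpha * Num.sqrt (pi * (1 + alpha) * ln m%:R)).
Proof.
move=> m1 s0 a0 tau.
have lm0 : 0 < ln m%:R :> R by rewrite ln_gt0// ltr1n.
have m0 : 0 < m%:R :> R by rewrite ltr0n ltnW.
pose l : R := (1 + alpha) * ln m%:R.
have l0 : 0 < l by rewrite mulr_gt0// addr_gt0.
have tau2 : tau ^+ 2 = sigma ^+ 2 * (2 * l).
  by rewrite exprMn sqr_sqrtr -?mulrA// mulr_ge0// ltW.
rewrite normal_pdf0E ?gt_eqF//.
have -> : - tau ^+ 2 / (sigma ^+ 2 *+ 2) = - l.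
  by rewrite tau2; field; rewrite gt_eqF.
rewrite expRN.
have -> : expR l = m%:R * m%:R `^ alpha.
  by rewrite /l mulrDl mul1r expRD lnK ?posrE// /powR gt_eqF.
have q1 : Num.sqrt (2 * (1 + alpha) * ln m%:R) = Num.sqrt 2 * Num.sqrt l.
  by rewrite -mulrA sqrtrM.
have q2 : Num.sqrt (sigma ^+ 2 * pi *+ 2) = sigma * (Num.sqrt 2 * Num.sqrt pi).
  rewrite -mulr_natl mulrCA sqrtrM ?sqr_ge0// sqrtr_sqr gtr0_norm//.
  by rewrite sqrtrM.
have q3 : Num.sqrt (pi * (1 + alpha) * ln m%:R) = Num.sqrt pi * Num.sqrt l.
  by rewrite -mulrA sqrtrM// pi_ge0.
have s2 : Num.sqrt 2 ^+ 2 = 2 :> R by rewrite sqr_sqrtr.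
rewrite /tau q1 q2 q3.
set sp := Num.sqrt pi; set sl := Num.sqrt l; set r2 := Num.sqrt 2.
set ma := _ `^ _.
have sp0 : sp != 0 by rewrite gt_eqF// sqrtr_gt0 pi_gt0.
have sl0 : sl != 0 by rewrite gt_eqF// sqrtr_gt0.
have r20 : r2 != 0 by rewrite gt_eqF// sqrtr_gt0.
have ma0 : ma != 0 by rewrite gt_eqF// powR_gt0.
rewrite -[X in m%:R * (X * _ / _ * _)]s2 -/r2.
field.
by rewrite ma0 sl0 sp0 r20 !gt_eqF.
Qed.

(** Each correlation has law N(0, sigma ^ 2); they are dependent, and the union
    bound takes care of that. *)
Lemma noise_correlations_small (n m : nat) (A : 'M[R]_(n, m)) (sigma tau : R)
    (w : 'I_n -> {RV P >-> R}) :
  (forall i, norm2 (col i A) = 1) -> (0 < m)%N -> 0 < sigma -> 0 < tau ->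
  white_gaussian sigma w ->
  let N := [set t | forall k, `|dot (col k A) (\col_i w i t)| < tau] in
  measurable N /\
  ((1 - m%:R * (2 * sigma ^+ 2 / tau * normal_pdf 0 sigma tau))%:E < P N)%E.
Proof.
move=> hA m0 s0 t0 wg N.
pose E k := [set t | tau <= `|dot (col k A) (\col_i w i t)|].
have mdot k : measurable_fun setT (fun t => dot (col k A) (\col_i w i t)).
  apply: measurable_dot => i; under eq_fun do rewrite mxE.
  exact: measurable_funPT.
have mE k : measurable (E k).
  by apply: measurable_ler => //; exact: measurableT_comp.
have mB : measurable [set x : R | tau <= `|x|] by exact: measurable_ler.
have PE k : P (E k) = normal_prob 0 sigma [set x : R | (tau <= `|x|)%R].
  have a1 : \sum_i A i k ^+ 2 = 1.
    rewrite -(dot_col_same (hA k)) dotE; apply: eq_bigr => i _.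
    by rewrite mxE expr2.
  rewrite -(law_combination s0 wg a1 mB); congr (P _).
  have dotwE t : dot (col k A) (\col_i w i t) = \sum_i A i k * w i t.
    by rewrite dotE; apply: eq_bigr => i _; rewrite !mxE.
  by apply/seteqP; split => t /=; rewrite /E/= dotwE.
have NE : N = ~` [set t | exists k, E k t].
  apply/seteqP; split => t /= h; first by move=> [k]; rewrite /E/= leNgt h.
  by move=> k; rewrite ltNge; apply/negP => hk; apply: h; exists k.
have mU : measurable [set t | exists k, E k t] by exact: measurable_exists.
split; first by rewrite NE; exact: measurableC.
rewrite NE probability_setC// EFinB.
rewrite -(fineK (fin_num_measure P _ mU)) -!EFinB lte_fin ltrD2l ltrN2 -lte_fin.
rewrite fineK ?fin_num_measure//; apply: le_lt_trans (union_bound mE) _.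
have tail := normal_prob_abs_ge_lt (lt0r_neq0 s0) t0.
have pB := fin_num_measure (normal_prob 0 sigma) _ mB.
rewrite -(fineK pB) lte_fin in tail.
under eq_bigr do rewrite PE -(fineK pB).
rewrite sumEFin sumr_const card_ord lte_fin -[ltLHS]mulr_natl.
by rewrite ltr_pM2l ?ltr0n.
Qed.
End noise_bound.

(** * The guarantees for OMP and thresholding *)

Unset Implicit Arguments.

Theorem theorem4 (R : realType) (d : measure_display) (T : measurableType d)
    (P : probability T R) (n m : nat) (A : 'M[R]_(n, m)) (x0 : 'cV[R]_m)
    (s : nat) (sigma alpha : R) (w : 'I_n -> {RV P >-> R})
    (hnm : (n < m)%N)
    (hA : forall i, norm2 (col i A) = 1)
    (hx0 : x0 != 0)
    (hs : norm0 x0 = s)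
    (hsigma : 0 < sigma)
    (hw : white_gaussian sigma w)
    (halpha : 0 < alpha) :
  let mu := coherence A in
  let logm : R := ln m%:R in
  let b (t : T) : 'cV[R]_n := A *m x0 + \col_i w i t in
  let prob_bound := 1 - 1 / (m%:R `^ alpha * Num.sqrt (pi * (1 + alpha) * logm)) in
  let accurate (x : 'cV[R]_m) :=
    norm2 (x - x0) ^+ 2
      <= 2 * (1 + alpha) / (1 - (s%:R - 1) * mu) ^+ 2 * s%:R * sigma ^+ 2 * logm
      <= 8 * (1 + alpha) * s%:R * sigma ^+ 2 * logm in
  let omp_success := [set t : T | forall L x r,
    omp_state A (b t) s L x r -> L = supp x0 /\ accurate x] in
  let threshold_success := [set t : T | forall L,
    threshold_support A (b t) s L ->
    L = supp x0 /\ accurate (ls_estimate A (b t) L)] in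
  (min_abs x0 - (2 * s%:R - 1) * mu * min_abs x0
     >= 2 * sigma * Num.sqrt (2 * (1 + alpha) * logm) ->
   measurable omp_success /\ (prob_bound%:E <= P omp_success)%E)
  /\
  (min_abs x0 - (2 * s%:R - 1) * mu * max_abs x0
     >= 2 * sigma * Num.sqrt (2 * (1 + alpha) * logm) ->
   measurable threshold_success /\ (prob_bound%:E < P threshold_success)%E).
Proof.
have m0 : (0 < m)%N by apply: leq_ltn_trans hnm.
have n0 : (0 < n)%N.
  rewrite lt0n; apply/eqP => n0; have /eqP := hA (Ordinal m0).
  rewrite /norm2 big1 ?sqrtr0 1?eq_sym ?oner_eq0// => i _.
  by exfalso; have := ltn_ord i; rewrite [X in (_ < X)%N]n0.
have m1 : (1 < m)%N by apply: leq_ltn_trans hnm.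
move=> mu logm b prob_bound accurate omp_success threshold_success.
subst s.
have logm0 : 0 < logm by rewrite ln_gt0// ltr1n.
pose tau := sigma * Num.sqrt (2 * (1 + alpha) * logm).
have tau0 : 0 < tau by rewrite mulr_gt0// sqrtr_gt0 !mulr_gt0// addr_gt0.
have [mN PN] := noise_correlations_small hA m0 hsigma tau0 hw.
rewrite tail_constant// -/logm -/prob_bound in PN.
set N := [set t | _] in mN PN.
have mb i : measurable_fun setT (fun t => b t i 0).
  under eq_fun do rewrite [_ i 0]mxE [X in _ + X]mxE.
  by apply: measurable_funD => //; exact: measurable_funPT.
have acc t : N t ->
    2 * tau <= min_abs x0 - (2 * (norm0 x0)%:R - 1) * mu * min_abs x0 ->
    accurate (ls_estimate A (b t) (supp x0)).
  move=> Nt h; rewrite /accurate.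
  have a0 : 0 <= 1 + alpha by rewrite addr_ge0// ltW.
  exact: (oracle_ls_accurate hA hx0 a0 (ltW logm0) (fun k => ltW (Nt k)) h).
split=> h.
- have mS : measurable omp_success by exact: measurable_omp_success.
  split => //; apply: ltW; apply: lt_le_trans PN _.
  apply: le_measure; rewrite ?inE// => t Nt L x r H.
  have h' : 2 * tau <= min_abs x0 - (2 * (norm0 x0)%:R - 1) * mu * min_abs x0.
    by rewrite mulrA.
  have LE := omp_recovers hA Nt hx0 h' H.
  split => //; have [-> _] := omp_state_ls H.
  by rewrite LE; exact: acc.
- have mS : measurable threshold_success by exact: measurable_threshold_success.
  split => //; apply: lt_le_trans PN _.
  apply: le_measure; rewrite ?inE// => t Nt L H.
  have h' : 2 * tau <= min_abs x0 - (2 * (norm0 x0)%:R - 1) * mu * max_abs x0.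
    by rewrite mulrA.
  have LE := threshold_recovers hA Nt h' H.
  split => //; rewrite LE; apply: acc => //; apply: le_trans h' _.
  rewrite lerD2l lerN2 ler_wpM2l ?min_abs_le_max_abs//.
  rewrite mulr_ge0 ?coherence_ge0//.
  have := norm0_ge1 hx0; lra.
Qed.
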